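(* Fix any $\mathbf{u}\in\mathcal{U}^m_a$, with $\mathbf{c}_u$, $\mathbf{a}$, $V_c$, $P_u$, $\mathcal{Z}_a$, $\mathcal{S}^+_a$, $P^d_u$, $\mathbf{G}$, $\boldsymbol\tau_u$ as in the context. If $\bar{\boldsymbol\zeta}\in\mathcal{S}^+_a$ is a solution of the canonical dual problem $(\mathcal{P}^d):\ \max\{P^d_u(\boldsymbol\zeta):\boldsymbol\zeta\in\mathcal{S}^+_a\}$, then $$\bar{\boldsymbol\rho}=\tfrac12\,\mathbf{G}(\bar{\boldsymbol\zeta})^{-1}\boldsymbol\tau_u(\bar{\boldsymbol\zeta})$$ is a global optimal solution of $(\mathcal{P}):\ \min\{P_u(\boldsymbol\rho):\boldsymbol\rho\in\mathcal{Z}_a\}$, and $$P_u(\bar{\boldsymbol\rho})=\min_{\boldsymbol\rho\in\mathcal{Z}_a}P_u(\boldsymbol\rho)=\max_{\boldsymbol\zeta\in\mathcal{S}^+_a}P^d_u(\boldsymbol\zeta)=P^d_u(\bar{\boldsymbol\zeta}).$$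
   Context: Setting (finite element topology optimization): a design domain is divided into $n$ finite elements $\Omega_e$; $\mathbf{a}=(a_1,\dots,a_n)$ with $a_e=\mathrm{Vol}(\Omega_e)>0$; $V_c>0$ is the desired volume; $\mathcal{U}^m_a\subset\mathbb{R}^m$ is the admissible nodal displacement space. For a given $\mathbf{u}\in\mathcal{U}^m_a$, $\mathbf{c}_u=\mathbf{c}(\mathbf{u})\in\mathbb{R}^n$ is the vector of element energies $c_e(\mathbf{u})=\int_{\Omega_e}W(\nabla\mathbf{N}(\mathbf{x})\mathbf{u}_e)\,d\Omega$ (with $W$ the stored energy density, $\mathbf{N}$ the interpolation matrix, $\mathbf{u}_e$ the element nodal displacements); these are nonnegative. $P_u(\boldsymbol\rho)=-\mathbf{c}_u^T\boldsymbol\rho$ and $\mathcal{Z}_a=\{\boldsymbol\rho\in\{0,1\}^n:\boldsymbol\rho^T\mathbf{a}\le V_c\}$ (so $(\mathcal{P})$ is a 0-1 knapsack problem). For $\boldsymbol\zeta=(\boldsymbol\sigma,\varsigma)\in\mathbb{R}^n\times\mathbb{R}$ let $\mathbf{G}(\boldsymbol\zeta)=\mathrm{Diag}(\boldsymbol\sigma)$ and $\boldsymbol\tau_u(\boldsymbol\zeta)=\boldsymbol\sigma-\varsigma\mathbf{a}+\mathbf{c}_u$. Let $\mathcal{S}^+_a=\{(\boldsymbol\sigma,\varsigma):\boldsymbol\sigma>0\ (\text{componentwise}),\ \varsigma\ge0\}$ and, on $\mathcal{S}^+_a$, $P^d_u(\boldsymbol\zeta)=-\frac14\boldsymbol\tau_u(\boldsymbol\zeta)^T\mathbf{G}(\boldsymbol\zeta)^{-1}\boldsymbol\tau_u(\boldsymbol\zeta)-\varsigma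 V_c$. A solution of $(\mathcal{P}^d)$ means a maximizer of $P^d_u$ attained in $\mathcal{S}^+_a$. *)

(* Defs.v *)
From HB Require Import structures.
From mathcomp Require Import all_boot all_order all_algebra.
From mathcomp Require Import all_classical all_reals all_analysis.

Set Implicit Arguments.
Unset Strict Implicit.
Unset Printing Implicit Defensive.

Import Order.TTheory GRing.Theory Num.Theory.
Import numFieldNormedType.Exports.

Local Open Scope classical_set_scope.
Local Open Scope ring_scope.

(* R^d with its Borel sigma-algebra. *)
Notation borel_rV R d := (g_sigma_algebraType (@open 'rV[R]_d)).

(* The value on boxes characterizes d-dimensional Lebesgue measure among the
   Borel measures on R^d. *)
Definition is_lebesgue (R : realType) (d : nat)
    (mu : {measure set (borel_rV R d) -> \bar R}) : Prop :=
  forall a b : 'rV[R]_d, (forall j, a 0 j <= b 0 j) ->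
    mu [set x : 'rV[R]_d | forall j, a 0 j <= x 0 j <= b 0 j]
    = (\prod_(j < d) (b 0 j - a 0 j))%:E.

(* u_e: [dof] sends the local degrees of freedom of an element to the global
   ones. *)
Definition restrict_dof (R : realType) (m k : nat) (dof : 'I_k -> 'I_m)
    (u : 'cV[R]_m) : 'cV[R]_k :=
  \col_i u (dof i) 0.

(* (grad N(x)) u_e, with entries \sum_l (d N_il / d x_j)(x) (u_e)_l. *)
Definition grad_interp (R : realType) (d k : nat) (N : 'rV[R]_d -> 'M[R]_(d, k))
    (ue : 'cV[R]_k) (x : 'rV[R]_d) : 'M[R]_d :=
  \matrix_(i, j)
    \sum_(l < k) 'D_('e_j) (fun y : 'rV[R]_d => N y i l : R^o) x * ue l 0.

Definition elt_energy (R : realType) (d k : nat)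
    (mu : {measure set (borel_rV R d) -> \bar R}) (E : set (borel_rV R d))
    (W : 'M[R]_d -> R) (N : 'rV[R]_d -> 'M[R]_(d, k)) (ue : 'cV[R]_k) : R :=
  \int[mu]_(x in E) W (grad_interp N ue x).

(* A design domain of R^d divided into n finite elements, with m global nodal
   degrees of freedom. Distinct elements may share boundary points, so they are
   only required to overlap in volume zero. *)
Record fe_model (R : realType) (d m n : nat) := FEModel {
  fe_vol : {measure set (borel_rV R d) -> \bar R} ;
  fe_vol_lebesgue : is_lebesgue fe_vol ;
  fe_domain : set (borel_rV R d) ;
  fe_elt : 'I_n -> set (borel_rV R d) ;
  fe_elt_measurable : forall e, measurable (fe_elt e) ;
  fe_elt_cover : \bigcup_e fe_elt e = fe_domain ;
  fe_elt_overlap : forall e f, e != f -> fe_vol (fe_elt e `&` fe_elt f) = 0%E ;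
  fe_elt_vol_gt0 : forall e, (0 < fe_vol (fe_elt e))%E ;
  fe_elt_vol_fin : forall e, (fe_vol (fe_elt e) < +oo)%E ;
  fe_ndof : 'I_n -> nat ;
  fe_dof : forall e, 'I_(fe_ndof e) -> 'I_m ;
  fe_interp : forall e, 'rV[R]_d -> 'M[R]_(d, fe_ndof e) ;
  fe_interp_diff : forall e i l, {ae fe_vol, forall x : borel_rV R d,
    fe_elt e x ->
    differentiable (fun y : 'rV[R]_d => fe_interp e y i l : R^o)
      (x : 'rV[R]_d)} ;
  fe_W : 'M[R]_d -> R ;
  fe_adm : set 'cV[R]_m ;
  fe_W_integrable : forall u, fe_adm u -> forall e,
    fe_vol.-integrable (fe_elt e) (fun x : borel_rV R d =>
      (fe_W (grad_interp (@fe_interp e) (restrict_dof (@fe_dof e) u) x))%:E) ;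
  fe_energy_ge0 : forall u, fe_adm u -> forall e,
    0 <= elt_energy fe_vol (fe_elt e) fe_W (@fe_interp e)
           (restrict_dof (@fe_dof e) u)
}.

Section topology_optimization.
Variables (R : realType) (d m n : nat) (M : fe_model R d m n).

Definition vol_vec : 'cV[R]_n := \col_e fine (fe_vol M (fe_elt M e)).

Definition energy_vec (u : 'cV[R]_m) : 'cV[R]_n :=
  \col_e elt_energy (fe_vol M) (fe_elt M e) (fe_W M) (@fe_interp _ _ _ _ M e)
           (restrict_dof (@fe_dof _ _ _ _ M e) u).

Definition Pu (u : 'cV[R]_m) (rho : 'cV[R]_n) : R :=
  - ((energy_vec u)^T *m rho) 0 0.

Definition Za (Vc : R) : set 'cV[R]_n :=
  [set rho : 'cV[R]_n | (forall e, rho e 0 = 0 \/ rho e 0 = 1)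
             /\ (rho^T *m vol_vec) 0 0 <= Vc].

Definition Gmx (zeta : 'cV[R]_n * R) : 'M[R]_n := diag_mx zeta.1^T.

Definition tau (u : 'cV[R]_m) (zeta : 'cV[R]_n * R) : 'cV[R]_n :=
  zeta.1 - zeta.2 *: vol_vec + energy_vec u.

Definition Sa_plus : set ('cV[R]_n * R) :=
  [set zeta : 'cV[R]_n * R | (forall e, 0 < zeta.1 e 0) /\ 0 <= zeta.2].

Definition Pdu (Vc : R) (u : 'cV[R]_m) (zeta : 'cV[R]_n * R) : R :=
  - (1 / 4) * ((tau u zeta)^T *m invmx (Gmx zeta) *m tau u zeta) 0 0
  - zeta.2 * Vc.

End topology_optimization.

Definition global_minimizer (R : realType) (T : Type) (A : set T) (f : T -> R)
    (x : T) : Prop :=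
  A x /\ forall y, A y -> f x <= f y.

Definition global_maximizer (R : realType) (T : Type) (A : set T) (f : T -> R)
    (x : T) : Prop :=
  A x /\ forall y, A y -> f y <= f x.

(* v = min_A f, the minimum being attained. *)
Definition is_min (R : realType) (T : Type) (A : set T) (f : T -> R) (v : R) :
    Prop :=
  (f @` A) v /\ lbound (f @` A) v.

(* v = max_A f, the maximum being attained. *)
Definition is_max (R : realType) (T : Type) (A : set T) (f : T -> R) (v : R) :
    Prop :=
  (f @` A) v /\ ubound (f @` A) v.

(* Main.v *)
Require Import Defs.
From mathcomp Require Import all_boot all_order all_algebra.
From mathcomp Require Import all_classical all_reals all_analysis.
From mathcomp Require Import ring lra.

(** For any rho, sigma and s, completing the square turns the difference between
    the primal cost of rho and the dual value at (sigma, s) into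
      sum_i sigma_i (rho_i - p_i)^2 + sum_i sigma_i (rho_i - rho_i^2)
        + s (V - rho^T a),   where p_i = tau_i / (2 sigma_i).
    When 0 <= rho <= 1 and rho^T a <= V all three terms are nonnegative: weak
    duality.  At a dual maximizer, optimality in sigma_i > 0 reads
    sigma_i = |c_i - s a_i|, so that p_i is 0 or 1, and optimality in s >= 0
    makes p feasible with s (V - p^T a) = 0; hence the gap vanishes at
    rho = p. *)

Set Implicit Arguments.
Unset Strict Implicit.
Unset Printing Implicit Defensive.

Import Order.TTheory GRing.Theory Num.Theory.
Local Open Scope classical_set_scope.
Local Open Scope ring_scope.

Lemma invmx_diag_mx (R : comUnitRingType) (n : nat) (v : 'rV[R]_n) :
  (forall i, v 0 i \is a GRing.unit) ->
  invmx (diag_mx v) = diag_mx (\row_i (v 0 i)^-1).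
Proof.
move=> v_unit; set w := \row_i _.
have vw1 : diag_mx v *m diag_mx w = 1%:M.
  rewrite mulmx_diag -diag_const_mx; congr diag_mx.
  by apply/rowP => i; rewrite !mxE mulrV.
have [diag_unit _] := mulmx1_unit vw1.
by rewrite -[RHS](mulKmx diag_unit) vw1 mulmx1.
Qed.

Lemma global_minimizer_is_min (R : realType) (T : Type) (A : set T)
    (f : T -> R) (x : T) :
  global_minimizer A f x -> is_min A f (f x).
Proof.
by move=> [Ax f_min]; split=> [|_ [y Ay <-]]; [exists x | exact: f_min].
Qed.

Lemma global_maximizer_is_max (R : realType) (T : Type) (A : set T)
    (f : T -> R) (x : T) :
  global_maximizer A f x -> is_max A f (f x).
Proof.
by move=> [Ax f_max]; split=> [|_ [y Ay <-]]; [exists x | exact: f_max].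
Qed.

Section OneVariable.
Variable R : realFieldType.
Implicit Types b s t D K h : R.

Lemma linear_le_quadratic_le0 D K :
  (forall t, 0 < t <= 1 -> t * D <= t ^+ 2 * K) -> D <= 0.
Proof.
move=> DK; rewrite leNgt; apply/negP => D_gt0.
have DK_gt0 : 0 < D + `|K| by rewrite ltr_wpDr.
pose t := D / (D + `|K|).
have t_gt0 : 0 < t by exact: divr_gt0.
have t_le1 : t <= 1 by rewrite ler_pdivrMr // mul1r lerDl.
have := DK t; rewrite t_gt0 t_le1 expr2 -mulrA ler_pM2l // => /(_ isT).
rewrite /t mulrAC ler_pdivlMr // ler_pM2l // => DK_le.
by have := ler_norm K; lra.
Qed.

Lemma quadratic_max_halfline s D K : 0 <= s ->
  (forall h, 0 <= s + h -> h * D <= h ^+ 2 * K) -> D <= 0 /\ s * D = 0.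
Proof.
move=> s_ge0 s_max.
have D_le0 : D <= 0.
  apply: (@linear_le_quadratic_le0 _ K) => h /andP[h_gt0 _].
  by apply: s_max; rewrite addr_ge0 // ltW.
have sD_ge0 : - (s * D) <= 0.
  apply: (@linear_le_quadratic_le0 _ (s ^+ 2 * K)) => t /andP[_ t_le1].
  have := s_max (- (t * s)); rewrite sqrrN exprMn mulNr -!mulrA mulrN; apply.
  by rewrite -[X in X - _]mul1r -mulrBl mulr_ge0 // subr_ge0.
by split=> //; apply/le_anti; rewrite mulr_ge0_le0 //= -oppr_le0.
Qed.

Lemma sqrrD_div_normE b t : t != 0 ->
  (t + b) ^+ 2 / t = (t - `|b|) ^+ 2 / t + 2 * (b + `|b|).
Proof.
move=> t_neq0; rewrite sqrrD sqrrB real_normK ?num_real //.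
by field.
Qed.

Lemma sqrrD_div_minimizer b s : 0 < s ->
  (forall t, 0 < t -> (s + b) ^+ 2 / s <= (t + b) ^+ 2 / t) -> s = `|b|.
Proof.
move=> s_gt0 s_min; have b_ge0 := normr_ge0 b.
(* The minimizer |b| itself may be 0, so s is compared with a midpoint. *)
pose t := (s + `|b|) / 2.
have t_gt0 : 0 < t by rewrite /t; lra.
have := s_min t t_gt0.
rewrite (sqrrD_div_normE b (lt0r_neq0 s_gt0)).
rewrite (sqrrD_div_normE b (lt0r_neq0 t_gt0)) lerD2r.
have -> : t - `|b| = (s - `|b|) / 2 by rewrite /t; field.
rewrite ler_pdivrMr // mulrAC ler_pdivlMr // => sqr_le.
have : (s - `|b|) ^+ 2 * (s + 2 * `|b|) <= 0.
  by move: sqr_le; rewrite exprMn /t; lra.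
rewrite pmulr_lle0 ?ltr_wpDr ?mulr_ge0 // => sqr_le0.
by apply/eqP; rewrite -subr_eq0 -sqrf_eq0 eq_le sqr_le0 sqr_ge0.
Qed.

End OneVariable.

Section KnapsackDuality.
Variables (R : realFieldType) (I : finType) (c a : I -> R) (V : R).
Implicit Types (sigma rho : I -> R) (s h : R) (i : I).

Definition knapsack_cost rho : R := - \sum_i c i * rho i.

Definition knapsack_feasible rho : Prop :=
  (forall i, rho i = 0 \/ rho i = 1) /\ \sum_i rho i * a i <= V.

Definition reduced_profit s i : R := c i - s * a i.

Definition knapsack_dual sigma s : R :=
  - (1 / 4) * (\sum_i (sigma i + reduced_profit s i) ^+ 2 / sigma i) - s * V.

Definition dual_feasible sigma s : Prop := (forall i, 0 < sigma i) /\ 0 <= s.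

Definition dual_maximizer sigma s : Prop :=
  dual_feasible sigma s /\
  forall sigma' s', dual_feasible sigma' s' ->
    knapsack_dual sigma' s' <= knapsack_dual sigma s.

Definition dual_point sigma s i : R :=
  (sigma i + reduced_profit s i) / (2 * sigma i).

Lemma duality_gapE sigma s rho : (forall i, sigma i != 0) ->
  knapsack_cost rho - knapsack_dual sigma s =
    \sum_i sigma i * (rho i - dual_point sigma s i) ^+ 2
    + \sum_i sigma i * (rho i - rho i ^+ 2)
    + s * (V - \sum_i rho i * a i).
Proof.
move=> sigma_neq0; rewrite /knapsack_cost /knapsack_dual.
have gap_sumE : - \sum_i c i * rho i
    + 1 / 4 * (\sum_i (sigma i + reduced_profit s i) ^+ 2 / sigma i) =
    \sum_i sigma i * (rho i - dual_point sigma s i) ^+ 2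
    + \sum_i sigma i * (rho i - rho i ^+ 2) - s * \sum_i rho i * a i.
  rewrite !mulr_sumr -!sumrN -!big_split; apply: eq_bigr => i _ /=.
  by rewrite /dual_point /reduced_profit; field.
by move: gap_sumE; lra.
Qed.

Lemma knapsack_weak_duality sigma s rho : dual_feasible sigma s ->
  (forall i, 0 <= rho i <= 1) -> \sum_i rho i * a i <= V ->
  knapsack_dual sigma s <= knapsack_cost rho.
Proof.
move=> [sigma_gt0 s_ge0] rho_box rho_le.
rewrite -subr_ge0 duality_gapE => [|i]; last by rewrite gt_eqF.
apply: addr_ge0; first apply: addr_ge0.
- by apply: sumr_ge0 => i _; rewrite mulr_ge0 ?sqr_ge0 ?ltW.
- apply: sumr_ge0 => i _; have /andP[rho_ge0 rho_le1] := rho_box i.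
  apply: mulr_ge0; first exact: ltW.
  by rewrite subr_ge0 expr2 ler_piMl.
- by rewrite mulr_ge0 // subr_ge0.
Qed.

Lemma knapsack_feasible_box rho i : knapsack_feasible rho -> 0 <= rho i <= 1.
Proof. by move=> [rho01 _]; case: (rho01 i) => ->; rewrite lexx ler01. Qed.

Lemma knapsack_dual_shift sigma s h : (forall i, sigma i != 0) ->
  knapsack_dual sigma (s + h) = knapsack_dual sigma s
    + h * (\sum_i dual_point sigma s i * a i - V)
    - h ^+ 2 * \sum_i a i ^+ 2 / (4 * sigma i).
Proof.
move=> sigma_neq0; rewrite /knapsack_dual.
have sumE : - (1 / 4) *
      (\sum_i (sigma i + reduced_profit (s + h) i) ^+ 2 / sigma i) =
    - (1 / 4) * (\sum_i (sigma i + reduced_profit s i) ^+ 2 / sigma i)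
    + h * (\sum_i dual_point sigma s i * a i)
    - h ^+ 2 * \sum_i a i ^+ 2 / (4 * sigma i).
  rewrite !mulr_sumr -sumrN -!big_split; apply: eq_bigr => i _ /=.
  by rewrite /dual_point /reduced_profit; field.
by rewrite sumE; ring.
Qed.

Section DualMaximizer.
Variables (sigma : I -> R) (s : R).
Hypothesis sigma_s_max : dual_maximizer sigma s.

Let sigma_gt0 i : 0 < sigma i. Proof. by case: sigma_s_max => -[]. Qed.
Let sigma_neq0 i : sigma i != 0. Proof. by rewrite gt_eqF. Qed.
Let s_ge0 : 0 <= s. Proof. by case: sigma_s_max => -[]. Qed.

Lemma dual_point_capacity :
  \sum_i dual_point sigma s i * a i <= V /\
  s * (\sum_i dual_point sigma s i * a i - V) = 0.
Proof.
rewrite -subr_le0.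
pose K := \sum_i a i ^+ 2 / (4 * sigma i).
apply: (@quadratic_max_halfline _ _ _ K) => // h sh_ge0.
have := sigma_s_max.2 sigma (s + h) (conj sigma_gt0 sh_ge0).
by rewrite knapsack_dual_shift // -/K; lra.
Qed.

Lemma dual_maximizer_coord i t : 0 < t ->
  (sigma i + reduced_profit s i) ^+ 2 / sigma i <=
  (t + reduced_profit s i) ^+ 2 / t.
Proof.
move=> t_gt0; pose sigma' j := if j == i then t else sigma j.
have sigma'_gt0 j : 0 < sigma' j by rewrite /sigma'; case: eqP.
have := sigma_s_max.2 sigma' s (conj sigma'_gt0 s_ge0).
have sigma'E :
    \sum_(j | j != i) (sigma' j + reduced_profit s j) ^+ 2 / sigma' j =
    \sum_(j | j != i) (sigma j + reduced_profit s j) ^+ 2 / sigma j.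
  by apply: eq_bigr => j /negPf j_neq_i; rewrite /sigma' j_neq_i.
rewrite /knapsack_dual (bigD1 i) //= [in leRHS](bigD1 i) //= sigma'E.
by rewrite {1 2}/sigma' eqxx; lra.
Qed.

Lemma dual_maximizer_sigmaE i : sigma i = `|reduced_profit s i|.
Proof. by apply: sqrrD_div_minimizer => // t; exact: dual_maximizer_coord. Qed.

Lemma dual_point01 i : dual_point sigma s i = 0 \/ dual_point sigma s i = 1.
Proof.
have := sigma_neq0 i; rewrite /dual_point dual_maximizer_sigmaE normr_eq0.
case: ger0P => _ profit_neq0; last by left; rewrite addNr mul0r.
by right; field.
Qed.

Lemma dual_point_feasible : knapsack_feasible (dual_point sigma s).
Proof. by split; [exact: dual_point01 | case: dual_point_capacity]. Qed.

Lemma knapsack_strong_duality :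
  knapsack_cost (dual_point sigma s) = knapsack_dual sigma s.
Proof.
apply/eqP; rewrite -subr_eq0 duality_gapE //.
have [_ slackness] := dual_point_capacity.
rewrite -opprB mulrN slackness oppr0 addr0 -big_split big1 // => i _ /=.
by case: (dual_point01 i) => ->; ring.
Qed.

End DualMaximizer.
End KnapsackDuality.

Section Coordinates.
Variables (R : realType) (d m n : nat) (M : fe_model R d m n).
Variables (Vc : R) (u : 'cV[R]_m).
Implicit Types (rho : 'cV[R]_n) (zeta : 'cV[R]_n * R).

Local Notation c := (energy_vec M u ^~ 0).
Local Notation a := (vol_vec M ^~ 0).

Lemma PuE rho : Pu M u rho = knapsack_cost c (rho ^~ 0).
Proof. by rewrite /Pu mxE; congr (- _); apply: eq_bigr => e _; rewrite mxE. Qed.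

Lemma ZaE rho : Za M Vc rho = knapsack_feasible a Vc (rho ^~ 0).
Proof.
rewrite /Za /knapsack_feasible /= mxE.
by congr (_ /\ (_ <= _)); apply: eq_bigr => e _; rewrite mxE.
Qed.

Lemma tauE zeta e :
  tau M u zeta e 0 = zeta.1 e 0 + reduced_profit c a zeta.2 e.
Proof. by rewrite /reduced_profit !mxE addrAC addrA. Qed.

Lemma invmx_Gmx zeta : Sa_plus zeta ->
  invmx (Gmx zeta) = diag_mx (\row_e (zeta.1 e 0)^-1).
Proof.
move=> [sigma_gt0 _]; rewrite /Gmx invmx_diag_mx => [|e].
  by congr diag_mx; apply/rowP => e; rewrite !mxE.
by rewrite mxE unitfE gt_eqF.
Qed.

Lemma PduE zeta : Sa_plus zeta ->
  Pdu M Vc u zeta = knapsack_dual c a Vc (zeta.1 ^~ 0) zeta.2.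
Proof.
move=> zetaS; rewrite /Pdu /knapsack_dual invmx_Gmx //.
congr (_ * _ - _); rewrite mxE; apply: eq_bigr => e _.
by rewrite mul_mx_diag mxE [_^T _ _]mxE [(\row__ _) _ _]mxE tauE mulrAC -expr2.
Qed.

Lemma dual_pointE zeta : Sa_plus zeta ->
  ((1 / 2) *: (invmx (Gmx zeta) *m tau M u zeta)) ^~ 0 =
  dual_point c a (zeta.1 ^~ 0) zeta.2.
Proof.
move=> zetaS; apply/funext => e; have [sigma_gt0 _] := zetaS.
rewrite invmx_Gmx // mxE mul_diag_mx mxE [(\row__ _) _ _]mxE tauE /dual_point.
by field; rewrite gt_eqF.
Qed.

Lemma Pdu_dual_maximizer zeta :
  global_maximizer (@Sa_plus R n) (Pdu M Vc u) zeta ->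
  dual_maximizer c a Vc (zeta.1 ^~ 0) zeta.2.
Proof.
move=> [zetaS zeta_max]; split=> // sigma s [sigma_gt0 s_ge0].
have colE : (\col_e sigma e : 'cV[R]_n) ^~ 0 = sigma.
  by apply/funext => e; rewrite mxE.
have colS : Sa_plus (\col_e sigma e : 'cV[R]_n, s).
  by split=> //= e; rewrite mxE.
by have := zeta_max _ colS; rewrite !PduE //= colE.
Qed.

End Coordinates.

Theorem theorem2 (R : realType) (d m n : nat) (M : fe_model R d m n)
    (Vc : R) (hVc : 0 < Vc) (u : 'cV[R]_m) (hu : fe_adm M u)
    (zeta : 'cV[R]_n * R)
    (hzeta : global_maximizer (@Sa_plus R n) (Pdu M Vc u) zeta) :
  let rho := (1 / 2) *: (invmx (Gmx zeta) *m tau M u zeta) in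
  global_minimizer (Za M Vc) (Pu M u) rho /\
  exists vmin vmax : R,
    [/\ is_min (Za M Vc) (Pu M u) vmin,
        is_max (@Sa_plus R n) (Pdu M Vc u) vmax
      & [/\ Pu M u rho = vmin, vmin = vmax & vmax = Pdu M Vc u zeta]].
Proof.
move=> rho; have [zetaS _] := hzeta.
have zeta_dual := Pdu_dual_maximizer hzeta.
have rho_feasible : Za M Vc rho.
  by rewrite ZaE dual_pointE //; exact: dual_point_feasible.
have zero_gap : Pu M u rho = Pdu M Vc u zeta.
  by rewrite PuE dual_pointE // PduE //; exact: knapsack_strong_duality.
have rho_min : global_minimizer (Za M Vc) (Pu M u) rho.
  split=> // y; rewrite ZaE zero_gap PduE // PuE => y_feasible.
  apply: knapsack_weak_duality => //; last by case: y_feasible.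
  by move=> e; exact: knapsack_feasible_box y_feasible.
split=> //; exists (Pu M u rho), (Pdu M Vc u zeta); split=> //.
- exact: global_minimizer_is_min.
- exact: global_maximizer_is_max.
Qed.
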